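(* Let $\gamma_0,\gamma_1,\gamma_2,\gamma_3$ be $4\times4$ Dirac matrices, let $m$ be a constant, and define the $4\times 4$ matrices \[ J_1=\tfrac12\gamma_0,\quad J_2=\tfrac{i}{2}\gamma_3,\quad J_3=\tfrac{i}{2}\gamma_3\gamma_0 . \] Let $V(x)$ be a smooth function satisfying, for some fixed $N\in\mathbf{N}$ and constants $C_0,\ldots,C_N$ not all zero, the higher stationary mKdV equation \[ \sum_{k=0}^{N} C_k S_k=0,\qquad S_k=\mathcal{Y}^k V', \] where $\mathcal{Y}=D_x^2+V^2+V_xD_x^{-1}V$, $D_x=\frac{d}{dx}$, and $D_x^{-1}$ denotes the inverse of $D_x$ (integration in $x$). Then the system of ODEs \[ \big(D_x-V(x)J_3-mJ_2\big)\varphi=0 \] for a four-component complex-valued function $\varphi(x)$ is integrable by quadratures.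
   Context: Dirac matrices are $4\times4$ matrices satisfying $\gamma_\mu\gamma_\nu+\gamma_\nu\gamma_\mu=2g_{\mu\nu}I$ with $g=\mathrm{diag}(1,-1,-1,-1)$. In the operator $\mathcal{Y}=D_x^2+V^2+V_xD_x^{-1}V$, the term $V_xD_x^{-1}V$ acts on a function $u$ as $V_x\cdot D_x^{-1}(Vu)$; $\mathcal{Y}$ is the recursion operator of the mKdV equation $V_t+V_{xxx}+\tfrac32V^2V_x=0$, and $S_k=\mathcal{Y}^kV'$ are its higher symmetries; for $N=1$ the equation reduces to $C_1(V'''+\tfrac32V^2V')+C_0'V'=0$ type stationary mKdV. ''Integrable by quadratures'' means that the general solution can be obtained by a finite sequence of algebraic operations, integrations of known functions, and compositions/exponentiations of known functions. *)

(* Defs.v *)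
From Stdlib Require Import Reals.
From Coquelicot Require Import Coquelicot.
Open Scope R_scope.

(** 4x4 complex matrices, indices 0..3 (entries outside are ignored). *)
Definition cmat := nat -> nat -> C.

Definition cmmul (A B : cmat) : cmat := fun i j =>
  (A i 0%nat * B 0%nat j + A i 1%nat * B 1%nat j
   + A i 2%nat * B 2%nat j + A i 3%nat * B 3%nat j)%C.

Definition minkowski (mu nu : nat) : R :=
  if Nat.eqb mu nu then (if Nat.eqb mu 0 then 1 else -1) else 0.

Definition kdelta (i j : nat) : C := if Nat.eqb i j then RtoC 1 else RtoC 0.

Definition is_Dirac (g : nat -> cmat) : Prop :=
  forall mu nu i j : nat, (mu < 4)%nat -> (nu < 4)%nat -> (i < 4)%nat -> (j < 4)%nat ->
    (cmmul (g mu) (g nu) i j + cmmul (g nu) (g mu) i j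
     = RtoC (2 * minkowski mu nu) * kdelta i j)%C.

Definition J1 (g : nat -> cmat) : cmat := fun i j => (RtoC (/2) * g 0%nat i j)%C.
Definition J2 (g : nat -> cmat) : cmat := fun i j => (Ci / RtoC 2 * g 3%nat i j)%C.
Definition J3 (g : nat -> cmat) : cmat :=
  fun i j => (Ci / RtoC 2 * cmmul (g 3%nat) (g 0%nat) i j)%C.

Definition Amat (g : nat -> cmat) (V : R -> R) (m : R) (x : R) : cmat :=
  fun i j => (RtoC (V x) * J3 g i j + RtoC m * J2 g i j)%C.

Definition is_solution (g : nat -> cmat) (V : R -> R) (m : R) (phi : nat -> R -> C) : Prop :=
  forall (i : nat) (x : R), (i < 4)%nat ->
    is_derive (phi i) x
      (Amat g V m x i 0%nat * phi 0%nat x + Amat g V m x i 1%nat * phi 1%nat x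
       + Amat g V m x i 2%nat * phi 2%nat x + Amat g V m x i 3%nat * phi 3%nat x)%C.

Definition smooth (f : R -> R) : Prop := forall (n : nat) (x : R), ex_derive_n f n x.

(** Recursion operator Y u = u'' + V^2 u + V_x D_x^{-1}(V u), with D_x^{-1} the
    integral from 0 (the choice of base point only adds multiples of lower S_j,
    which are absorbed by the arbitrary constants C_k). *)
Definition Yop (V : R -> R) (u : R -> R) : R -> R := fun x =>
  Derive_n u 2 x + (V x) ^ 2 * u x + Derive V x * RInt (fun t => V t * u t) 0 x.

Definition Ssym (V : R -> R) (k : nat) : R -> R := Nat.iter k (Yop V) (Derive V).

Definition stationary_mKdV (V : R -> R) (N : nat) (Cs : nat -> R) : Prop :=
  forall x : R, sum_n (fun k => Cs k * Ssym V k x) N = 0.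

(** Functions on the interval (a,b) obtainable by quadratures from V:
    the smallest class containing the complex constants, x, and V and its
    derivatives, closed under (equality on (a,b)), sums, products, inverses
    of nowhere-vanishing functions, integration (antiderivatives),
    exponentials of integrals (f' = g f), and continuous algebraic functions
    (roots of polynomials with coefficients in the class). *)
Inductive quad (V : R -> R) (a b : R) : (R -> C) -> Prop :=
| q_const (c : C) : quad V a b (fun _ => c)
| q_id : quad V a b (fun x => RtoC x)
| q_V (n : nat) : quad V a b (fun x => RtoC (Derive_n V n x))
| q_ext (f h : R -> C) : quad V a b h -> (forall x, a < x < b -> f x = h x) -> quad V a b f
| q_add (f h : R -> C) : quad V a b f -> quad V a b h -> quad V a b (fun x => (f x + h x)%C)
| q_mul (f h : R -> C) : quad V a b f -> quad V a b h -> quad V a b (fun x => (f x * h x)%C)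
| q_inv (f : R -> C) : quad V a b f -> (forall x, a < x < b -> f x <> RtoC 0) ->
    quad V a b (fun x => (/ f x)%C)
| q_int (f h : R -> C) : quad V a b h -> (forall x, a < x < b -> is_derive f x (h x)) ->
    quad V a b f
| q_expint (f h : R -> C) : quad V a b h ->
    (forall x, a < x < b -> is_derive f x (h x * f x)%C) -> quad V a b f
| q_alg (f : R -> C) (cs : nat -> R -> C) (n : nat) :
    (0 < n)%nat -> (forall k, (k <= n)%nat -> quad V a b (cs k)) ->
    (forall x, a < x < b -> cs n x <> RtoC 0) ->
    (forall x, a < x < b -> sum_n (fun k => (cs k x * pow_n (f x) k)%C) n = RtoC 0) ->
    (forall x, a < x < b -> continuous f x) ->
    quad V a b f.

(* Main.v *)
(** With respect to the two eigenspaces of [J3], the Dirac-type system splits into scalar systems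
      y' = (i/2) (V y + m z),   z' = -(i/2) (V z + m y).
    If [Y u = m^2 u - p V'] and [w = p + D^-1 (V u)], then
    [Q = m u J1 + m w J2 + (u' + V w) J3] satisfies [Q' = [V J3 + m J2, Q]], so [Q] maps solutions
    to solutions and [Q^2] is a constant scalar [lam^2]. Such a pair [(u, p)] is obtained by
    dividing the polynomial [sum C_k X^k] by [X - m^2]: [u] is the quotient applied to [V'] and [p]
    is the remainder. Where the [J1], [J2] components of [Q] do not both vanish, the relation
    [Q psi = lam psi + f] eliminates [z] and leaves a first order linear equation for [y]; this is
    used twice, for [chi = (Q - lam) phi], which satisfies [Q chi = - lam chi], and then for [phi]
    itself with [f = chi], so that no case distinction on [lam] is needed. For [m = 0] the two
    scalar equations decouple. *)

Require Import Defs.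
From Stdlib Require Import Reals Lra Lia Classical_Prop FunctionalExtensionality.
From Coquelicot Require Import Coquelicot.
Open Scope R_scope.

(** * Complex-valued functions of a real variable *)

Lemma C_ext (z w : C) : Re z = Re w -> Im z = Im w -> z = w.
Proof. destruct z, w; simpl; now intros -> ->. Qed.

(** Complex derivatives are taken over the real field, so projecting to the two coordinates is
    linear. Conversely [f] is recombined as [Re f] times 1 plus [Im f] times i. This brings the
    complex product rule down to the real one. *)
Lemma is_derive_Re_Im (f : R -> C) (x : R) (l : C) :
  is_derive f x l <->
  is_derive (fun t => Re (f t)) x (Re l) /\ is_derive (fun t => Im (f t)) x (Im l).
Proof.
  split.
  - intros Hf; split.
    + refine (filterdiff_comp' f (fst : C_R_NormedModule -> R_NormedModule) x _ fst Hf _).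
      apply filterdiff_linear, is_linear_fst.
    + refine (filterdiff_comp' f (snd : C_R_NormedModule -> R_NormedModule) x _ snd Hf _).
      apply filterdiff_linear, is_linear_snd.
  - intros [Hr Hi].
    assert (H : is_derive (fun t => plus (scal (Re (f t)) ((1, 0) : C_R_NormedModule))
                                 (scal (Im (f t)) ((0, 1) : C_R_NormedModule))) x
                (plus (scal (Re l) ((1, 0) : C_R_NormedModule))
                      (scal (Im l) ((0, 1) : C_R_NormedModule)))).
    { apply @is_derive_plus; now apply @is_derive_scal_l. }
    assert (E : forall z : C, plus (scal (Re z) ((1, 0) : C_R_NormedModule))
                  (scal (Im z) ((0, 1) : C_R_NormedModule)) = z).
    { intros [p q]; apply C_ext; cbn; ring. }
    rewrite E in H.
    eapply is_derive_ext; [ | exact H]. intros t; apply E.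
Qed.

Lemma is_derive_Cconst (c : C) (x : R) : is_derive (fun _ : R => c) x (RtoC 0).
Proof. exact (@is_derive_const R_AbsRing C_R_NormedModule c x). Qed.

Lemma is_derive_RtoC (f : R -> R) (x l : R) :
  is_derive f x l -> is_derive (fun t => RtoC (f t)) x (RtoC l).
Proof.
  intros H; apply is_derive_Re_Im; split; [exact H|].
  exact (@is_derive_const R_AbsRing R_NormedModule 0 x).
Qed.

Lemma is_derive_Cplus (f h : R -> C) (x : R) (l k : C) :
  is_derive f x l -> is_derive h x k -> is_derive (fun t => (f t + h t)%C) x (l + k)%C.
Proof. exact (@is_derive_plus R_AbsRing C_R_NormedModule f h x l k). Qed.

Lemma is_derive_Cmult (f h : R -> C) (x : R) (l k : C) :
  is_derive f x l -> is_derive h x k ->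
  is_derive (fun t => (f t * h t)%C) x (l * h x + f x * k)%C.
Proof.
  rewrite !is_derive_Re_Im; intros [Fr Fi] [Hr Hi]; split.
  - eapply is_derive_ext; [intros t; symmetry; apply re_mult|].
    replace (Re (l * h x + f x * k)%C) with
      ((Re l * Re (h x) + Re (f x) * Re k) - (Im l * Im (h x) + Im (f x) * Im k))
      by (rewrite re_plus, !re_mult; ring).
    apply @is_derive_minus; now apply Derive.is_derive_mult.
  - eapply is_derive_ext; [intros t; symmetry; apply im_mult|].
    replace (Im (l * h x + f x * k)%C) with
      ((Re l * Im (h x) + Re (f x) * Im k) + (Im l * Re (h x) + Im (f x) * Re k))
      by (rewrite im_plus, !im_mult; ring).
    apply @is_derive_plus; now apply Derive.is_derive_mult.
Qed.

Lemma is_derive_Cscal (c : C) (f : R -> C) (x : R) (l : C) :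
  is_derive f x l -> is_derive (fun t => (c * f t)%C) x (c * l)%C.
Proof.
  intros H. replace (c * l)%C with (RtoC 0 * f x + c * l)%C by ring.
  apply (is_derive_Cmult (fun _ => c) f); [apply is_derive_Cconst | exact H].
Qed.

Lemma is_derive_eq (f : R -> C) (x : R) (l k : C) :
  is_derive f x l -> l = k -> is_derive f x k.
Proof. now intros H <-. Qed.

Lemma is_derive_Cext (f h : R -> C) (x : R) (l : C) :
  (forall t, f t = h t) -> is_derive f x l -> is_derive h x l.
Proof. exact (@is_derive_ext R_AbsRing C_R_NormedModule f h x l). Qed.

(** Continuity is asked only inside the open interval, because the coefficients met later may blow
    up at its ends. Integrating from the midpoint keeps every integration range inside. *)
Lemma open_antiderivative (p : R -> R) (a b : R) :
  a < b -> (forall x, a < x < b -> continuous p x) ->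
  exists P : R -> R, forall x, a < x < b -> is_derive P x (p x).
Proof.
  intros Hab Hp. set (c := (a + b) / 2).
  exists (fun x => RInt p c x). intros x Hx.
  apply (is_derive_RInt p _ c x); [|now apply Hp].
  assert (Hd : 0 < Rmin (x - a) (b - x)) by (apply Rmin_glb_lt; lra).
  exists (mkposreal _ Hd). intros y Hy.
  assert (Hy' : Rabs (y - x) < Rmin (x - a) (b - x)) by exact Hy.
  apply Rabs_def2 in Hy'.
  pose proof (Rmin_l (x - a) (b - x)). pose proof (Rmin_r (x - a) (b - x)).
  apply (@RInt_correct R_CompleteNormedModule p c y).
  apply (@ex_RInt_continuous R_CompleteNormedModule). intros z Hz. apply Hp.
  assert (a < c < b) by (unfold c; lra).
  unfold Rmin, Rmax in Hz; destruct (Rle_dec c y); lra.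
Qed.

Definition continuous_Re_Im (f : R -> C) (x : R) : Prop :=
  continuous (fun t => Re (f t)) x /\ continuous (fun t => Im (f t)) x.

Lemma continuous_Re_Im_const (c : C) (x : R) : continuous_Re_Im (fun _ => c) x.
Proof. split; apply continuous_const. Qed.

Lemma continuous_Re_Im_RtoC (f : R -> R) (x : R) :
  continuous f x -> continuous_Re_Im (fun t => RtoC (f t)) x.
Proof. intros H; split; [exact H | apply continuous_const]. Qed.

Lemma continuous_Re_Im_plus (f h : R -> C) (x : R) :
  continuous_Re_Im f x -> continuous_Re_Im h x ->
  continuous_Re_Im (fun t => (f t + h t)%C) x.
Proof.
  intros [? ?] [? ?]; split;
    now apply (@continuous_plus R_UniformSpace R_AbsRing R_NormedModule).
Qed.

Lemma continuous_Re_Im_mult (f h : R -> C) (x : R) :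
  continuous_Re_Im f x -> continuous_Re_Im h x ->
  continuous_Re_Im (fun t => (f t * h t)%C) x.
Proof.
  intros [? ?] [? ?]; split.
  - apply continuous_ext with (fun t => Re (f t) * Re (h t) - Im (f t) * Im (h t)).
    { intros t; symmetry; apply re_mult. }
    apply (@continuous_minus R_UniformSpace R_AbsRing R_NormedModule);
      now apply (@continuous_mult R_UniformSpace R_AbsRing).
  - apply continuous_ext with (fun t => Re (f t) * Im (h t) + Im (f t) * Re (h t)).
    { intros t; symmetry; apply im_mult. }
    apply (@continuous_plus R_UniformSpace R_AbsRing R_NormedModule);
      now apply (@continuous_mult R_UniformSpace R_AbsRing).
Qed.

(** With primitives [P] of [Re h] and [Q] of [Im h], the function exp(P + iQ) works, written out by
    Euler's formula. Its modulus exp(P) is positive even outside the interval. *)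
Lemma exp_antiderivative (h : R -> C) (a b : R) :
  a < b -> (forall x, a < x < b -> continuous_Re_Im h x) ->
  exists E : R -> C, (forall x, E x <> RtoC 0) /\
    forall x, a < x < b -> is_derive E x (h x * E x)%C.
Proof.
  intros Hab Hc.
  assert (Hr := fun x Hx => proj1 (Hc x Hx)). assert (Hi := fun x Hx => proj2 (Hc x Hx)).
  destruct (open_antiderivative _ a b Hab Hr) as [P HP].
  destruct (open_antiderivative _ a b Hab Hi) as [Q HQ].
  exists (fun x => (exp (P x) * cos (Q x), exp (P x) * sin (Q x))). split.
  - intros x H. injection H as H1 H2.
    pose proof (exp_pos (P x)). pose proof (sin2_cos2 (Q x)) as H3. unfold Rsqr in H3.
    assert (cos (Q x) = 0) by (apply Rmult_integral in H1; destruct H1; lra).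
    assert (sin (Q x) = 0) by (apply Rmult_integral in H2; destruct H2; lra).
    nra.
  - intros x Hx. specialize (HP x Hx). specialize (HQ x Hx).
    assert (DP : Derive (fun t => P t) x = Re (h x)) by now apply is_derive_unique.
    assert (DQ : Derive (fun t => Q t) x = Im (h x)) by now apply is_derive_unique.
    apply is_derive_Re_Im; cbn [Re Im fst snd]; split.
    + auto_derive; [repeat split; eexists; eassumption|].
      rewrite DP, DQ, re_mult.
      cbn [Re Im fst snd]. ring.
    + auto_derive; [repeat split; eexists; eassumption|].
      rewrite DP, DQ, im_mult.
      cbn [Re Im fst snd]. ring.
Qed.

(** * First order linear equations are solved by quadratures *)

Lemma quad_scal V a b (c : C) f : quad V a b f -> quad V a b (fun x => (c * f x)%C).
Proof. intros H; apply (q_mul V a b (fun _ => c) f); [constructor | exact H]. Qed.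

(** Integrating factor: if F' = - h F then (y F)' = f F, so y F is an integral, and y is recovered
    by dividing by the nowhere vanishing F. *)
Lemma quad_linear_ode V (a b : R) (h f y : R -> C) :
  a < b -> quad V a b h -> quad V a b f ->
  (forall x, a < x < b -> continuous_Re_Im h x) ->
  (forall x, a < x < b -> is_derive y x (h x * y x + f x)%C) ->
  quad V a b y.
Proof.
  intros Hab Qh Qf Hc Hy.
  destruct (exp_antiderivative (fun x => - h x)%C a b Hab) as [F [F0 HF]].
  { intros x Hx; destruct (Hc x Hx); split;
      now apply (@continuous_opp R_UniformSpace R_AbsRing R_NormedModule). }
  assert (QF : quad V a b F).
  { apply (q_expint V a b F (fun x => - h x)%C); [|exact HF].
    apply q_ext with (fun x => - RtoC 1 * h x)%C; [now apply quad_scal|].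
    intros; ring. }
  assert (QyF : quad V a b (fun x => y x * F x)%C).
  { apply q_int with (fun x => f x * F x)%C; [now apply q_mul|].
    intros x Hx. eapply is_derive_eq; [apply is_derive_Cmult; [now apply Hy | now apply HF]|].
    ring. }
  apply q_ext with (fun x => y x * F x * / F x)%C.
  - apply (q_mul V a b (fun x => y x * F x)%C (fun x => / F x)%C QyF).
    now apply q_inv.
  - intros x _. field. apply F0.
Qed.

Definition reduced_system (V : R -> R) (m : R) (y z : R -> C) : Prop :=
  forall x,
    is_derive y x (Ci / RtoC 2 * (RtoC (V x) * y x + RtoC m * z x))%C /\
    is_derive z x (- (Ci / RtoC 2) * (RtoC (V x) * z x + RtoC m * y x))%C.

Lemma quad_real_inv V a b (f : R -> R) :
  (forall x, a < x < b -> f x <> 0) ->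
  quad V a b (fun x => RtoC (f x)) -> quad V a b (fun x => RtoC (/ f x)).
Proof.
  intros Hf Qf. apply q_ext with (fun x => / RtoC (f x))%C.
  - apply (q_inv V a b _ Qf). intros x Hx H. injection H. now apply Hf.
  - intros x Hx. rewrite RtoC_inv; auto.
Qed.

Lemma Ci_sqr : (Ci * Ci = - RtoC 1)%C.
Proof. apply C_ext; simpl; ring. Qed.

(** * The reduced system in the presence of an invariant *)

Section Reduction.

Variables (V : R -> R) (m a b : R) (al be ga : R -> R).
Hypothesis ab : a < b.
Hypothesis QV : quad V a b (fun x => RtoC (V x)).
Hypothesis Qal : quad V a b (fun x => RtoC (al x)).
Hypothesis Qbe : quad V a b (fun x => RtoC (be x)).
Hypothesis Qga : quad V a b (fun x => RtoC (ga x)).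
Hypothesis Vc : forall x, continuous V x.
(* Componentwise form of [Q' = [V J3 + m J2, Q]] for [Q = al J1 + be J2 + ga J3]. *)
Hypothesis alD : forall x, is_derive al x (m * ga x - V x * be x).
Hypothesis beD : forall x, is_derive be x (V x * al x).
Hypothesis gaD : forall x, is_derive ga x (m * al x).
Hypothesis nz : forall x, a < x < b -> al x ^ 2 + be x ^ 2 <> 0.

Let rho x := al x ^ 2 + be x ^ 2.
(* Inverse of [al + i be] where that does not vanish. *)
Let winv x : C := ((RtoC (al x) + - Ci * RtoC (be x)) * RtoC (/ rho x))%C.

Lemma winvE x : a < x < b -> ((RtoC (al x) + Ci * RtoC (be x)) * winv x = 1)%C.
Proof.
  intros Hx. unfold winv.
  replace ((al x + Ci * be x) * ((al x + - Ci * be x) * (/ rho x)%R))%C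
    with ((al x * al x - (Ci * Ci) * (be x * be x)) * (/ rho x)%R)%C by ring.
  rewrite Ci_sqr.
  replace (al x * al x - - RtoC 1 * (be x * be x))%C with (RtoC (rho x)).
  - rewrite <- RtoC_mult, Rinv_r; auto. now apply nz.
  - unfold rho. apply C_ext; simpl; ring.
Qed.

Lemma quad_winv : quad V a b winv.
Proof.
  apply (q_mul V a b (fun x => RtoC (al x) + - Ci * RtoC (be x))%C).
  - apply (q_add V a b _ (fun x => - Ci * RtoC (be x))%C Qal). now apply quad_scal.
  - apply quad_real_inv; [exact nz|].
    apply q_ext with (fun x => RtoC (al x) * RtoC (al x) + RtoC (be x) * RtoC (be x))%C.
    + apply (q_add V a b (fun x => RtoC (al x) * RtoC (al x))%C
                         (fun x => RtoC (be x) * RtoC (be x))%C); now apply q_mul.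
    + intros x _. unfold rho. apply C_ext. simpl. ring. simpl. ring.
Qed.

Lemma is_derive_continuous (f : R -> R) x l : is_derive f x l -> continuous f x.
Proof.
  intros H. apply (@ex_derive_continuous R_AbsRing R_NormedModule). now exists l.
Qed.

Lemma continuous_winv x : a < x < b -> continuous_Re_Im winv x.
Proof.
  intros Hx. assert (ca := is_derive_continuous _ _ _ (alD x)).
  assert (cb := is_derive_continuous _ _ _ (beD x)).
  apply continuous_Re_Im_mult.
  - apply continuous_Re_Im_plus; [now apply continuous_Re_Im_RtoC|].
    apply continuous_Re_Im_mult; [apply continuous_Re_Im_const|].
    now apply continuous_Re_Im_RtoC.
  - apply continuous_Re_Im_RtoC.
    apply (@ex_derive_continuous R_AbsRing R_NormedModule).
    unfold rho. auto_derive. repeat split; [eexists; apply alD | eexists; apply beD|].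
    specialize (nz x Hx). simpl in nz. auto.
Qed.

Lemma quad_of_eigen_relation (lam : C) (f y z : R -> C) :
  quad V a b f -> reduced_system V m y z ->
  (forall x, a < x < b ->
    (Ci * RtoC (ga x) * y x + (RtoC (al x) + Ci * RtoC (be x)) * z x) / RtoC 2
    = lam * y x + f x)%C ->
  quad V a b y /\ quad V a b z.
Proof.
  intros Qf S R.
  assert (Z : forall x, a < x < b ->
    z x = (winv x * ((RtoC 2 * lam + - Ci * RtoC (ga x)) * y x + RtoC 2 * f x))%C).
  { intros x Hx. specialize (R x Hx).
    replace (z x) with ((al x + Ci * be x) * winv x * z x)%C by (rewrite winvE by easy; ring).
    transitivity (winv x * (RtoC 2 * ((Ci * ga x * y x + (al x + Ci * be x) * z x) / RtoC 2)
       - Ci * ga x * y x))%C; [field|].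
    rewrite R. ring. }
  pose (k x := (RtoC 2 * lam + - Ci * RtoC (ga x))%C).
  assert (Qk : quad V a b k).
  { apply (q_add V a b (fun _ => RtoC 2 * lam)%C (fun x => - Ci * RtoC (ga x))%C);
      [constructor | now apply quad_scal]. }
  (* Substituting this expression for z into the equation of y leaves y' = h y + i m winv f. *)
  pose (h x := (Ci / RtoC 2 * (RtoC (V x) + RtoC m * (winv x * k x)))%C).
  assert (Qh : quad V a b h).
  { apply quad_scal.
    apply (q_add V a b (fun x => RtoC (V x)) (fun x => RtoC m * (winv x * k x))%C QV).
    apply quad_scal. now apply q_mul; [apply quad_winv|]. }
  assert (Qy : quad V a b y).
  { apply (quad_linear_ode V a b h
             (fun x => (Ci / RtoC 2 * RtoC m * RtoC 2) * (winv x * f x))%C); auto.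
    - apply quad_scal. apply q_mul; [apply quad_winv | easy].
    - intros x Hx. apply continuous_Re_Im_mult; [apply continuous_Re_Im_const|].
      apply continuous_Re_Im_plus; [now apply continuous_Re_Im_RtoC|].
      apply continuous_Re_Im_mult; [apply continuous_Re_Im_const|].
      apply continuous_Re_Im_mult; [now apply continuous_winv|].
      apply continuous_Re_Im_plus; [apply continuous_Re_Im_const|].
      apply continuous_Re_Im_mult; [apply continuous_Re_Im_const|].
      apply continuous_Re_Im_RtoC. apply (is_derive_continuous _ _ _ (gaD x)).
    - intros x Hx. eapply is_derive_eq; [exact (proj1 (S x))|]. rewrite (Z x Hx).
      unfold h, k, Cdiv. generalize (winv x) (/ RtoC 2)%C. intros. ring. }
  split; [exact Qy|].
  apply q_ext with (fun x => winv x * (k x * y x + RtoC 2 * f x))%C; [|exact Z].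
  apply q_mul; [apply quad_winv|].
  apply (q_add V a b (fun x => k x * y x)%C (fun x => RtoC 2 * f x)%C);
    [now apply q_mul | now apply quad_scal].
Qed.

(** This is four times the scalar Q^2; the terms of its derivative cancel in pairs. *)
Lemma invariant_const x : al x ^ 2 + be x ^ 2 - ga x ^ 2 = al 0 ^ 2 + be 0 ^ 2 - ga 0 ^ 2.
Proof.
  pose (F x := al x ^ 2 + be x ^ 2 - ga x ^ 2). change (F x = F 0).
  assert (D : forall t, is_derive F t 0).
  { intros t. unfold F. auto_derive.
    - repeat split; [eexists; apply alD | eexists; apply beD | eexists; apply gaD].
    - assert (E1 : Derive (fun x => al x) t = _) by (apply is_derive_unique, alD).
      assert (E2 : Derive (fun x => be x) t = _) by (apply is_derive_unique, beD).
      assert (E3 : Derive (fun x => ga x) t = _) by (apply is_derive_unique, gaD).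
      rewrite E1, E2, E3. ring. }
  assert (K : forall s t, s < t -> F s = F t).
  { intros s t. apply (@eq_is_derive R_NormedModule). intros; apply D. }
  destruct (Rtotal_order x 0) as [H|[->|H]]; [now apply K | easy | symmetry; now apply K].
Qed.

(** The constant Q^2 can be negative, in which case the eigenvalue [lam] is imaginary. *)
Lemma C_sqrt_real (k : R) : exists l : C, (l * l = RtoC k)%C.
Proof.
  destruct (Rle_dec 0 k) as [H|H].
  - exists (RtoC (sqrt k)). rewrite <- RtoC_mult, sqrt_sqrt; auto.
  - exists (Ci * RtoC (sqrt (- k)))%C.
    replace (Ci * sqrt (- k) * (Ci * sqrt (- k)))%C
      with ((Ci * Ci) * (sqrt (-k) * sqrt (- k)))%C by ring.
    rewrite Ci_sqr, <- RtoC_mult, sqrt_sqrt by lra. apply C_ext; simpl; ring.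
Qed.

Lemma quad_reduced_system (y z : R -> C) :
  reduced_system V m y z -> quad V a b y /\ quad V a b z.
Proof.
  intros S.
  destruct (C_sqrt_real ((al 0 ^ 2 + be 0 ^ 2 - ga 0 ^ 2) / 4)) as [lam Hlam].
  (* [(y1, z1) = (Q - lam) (y, z)]. *)
  pose (y1 x := ((Ci * RtoC (ga x) * y x + (RtoC (al x) + Ci * RtoC (be x)) * z x) / RtoC 2
                 - lam * y x)%C).
  pose (z1 x := (((RtoC (al x) + - Ci * RtoC (be x)) * y x + - Ci * RtoC (ga x) * z x) / RtoC 2
                 - lam * z x)%C).
  (* Since Q' = [V J3 + m J2, Q], the matrix Q - lam commutes with D_x - V J3 - m J2. *)
  assert (S1 : reduced_system V m y1 z1).
  { pose (h := (/ RtoC 2)%C).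
    assert (Hh : (h + h = RtoC 1)%C) by (unfold h; field).
    (* The factor [h + h] makes the identities below polynomial in [h]. *)
    assert (cal : forall x,
      is_derive (fun t => RtoC (al t)) x ((h + h) * (m * ga x - V x * be x))%C).
    { intros x. eapply is_derive_eq; [apply is_derive_RtoC, alD|].
      rewrite Hh, RtoC_minus, !RtoC_mult. ring. }
    assert (cbe : forall x, is_derive (fun t => RtoC (be t)) x ((h + h) * (V x * al x))%C).
    { intros x. eapply is_derive_eq; [apply is_derive_RtoC, beD|].
      rewrite Hh, RtoC_mult. ring. }
    assert (cga : forall x, is_derive (fun t => RtoC (ga t)) x ((h + h) * (m * al x))%C).
    { intros x. eapply is_derive_eq; [apply is_derive_RtoC, gaD|].
      rewrite Hh, RtoC_mult. ring. }
    intros x. destruct (S x) as [Sy Sz]. specialize (cal x). specialize (cbe x).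
    specialize (cga x). split.
    - apply (is_derive_Cext (fun t => h * (Ci * (RtoC (ga t) * y t)
               + (RtoC (al t) + Ci * RtoC (be t)) * z t) + - lam * y t)%C).
      { intros t. unfold y1, h, Cdiv. ring. }
      eapply is_derive_eq.
      { apply is_derive_Cplus; [|apply is_derive_Cscal, Sy].
        apply is_derive_Cscal, is_derive_Cplus.
        - apply is_derive_Cscal, is_derive_Cmult; [apply cga | apply Sy].
        - apply is_derive_Cmult; [|apply Sz].
          apply is_derive_Cplus; [apply cal | apply is_derive_Cscal, cbe]. }
      unfold y1, z1, Cdiv; fold h; cbv beta.  ring [Ci_sqr].
    - apply (is_derive_Cext (fun t => h * ((RtoC (al t) + - Ci * RtoC (be t)) * y t
               + - Ci * (RtoC (ga t) * z t)) + - lam * z t)%C).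
      { intros t. unfold z1, h, Cdiv. ring. }
      eapply is_derive_eq.
      { apply is_derive_Cplus; [|apply is_derive_Cscal, Sz].
        apply is_derive_Cscal, is_derive_Cplus.
        - apply is_derive_Cmult; [|apply Sy].
          apply is_derive_Cplus; [apply cal | apply is_derive_Cscal, cbe].
        - apply is_derive_Cscal, is_derive_Cmult; [apply cga | apply Sz]. }
      unfold y1, z1, Cdiv; fold h; cbv beta.  ring [Ci_sqr]. }
  (* First pass, homogeneous with eigenvalue -lam. Only the first component [y1] is kept: it is the
     inhomogeneity of the second pass. *)
  destruct (quad_of_eigen_relation (- lam)%C (fun _ => RtoC 0) y1 z1) as [Q1 _]; auto.
  - constructor.
  - intros x _.
    (* From Q^2 = lam^2 follows Q (Q - lam) = - lam (Q - lam); what is checked below is the first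
       row of this identity. *)
    assert (K : (al x * al x + be x * be x - ga x * ga x = RtoC 4 * (lam * lam))%C).
    { rewrite Hlam, <- !RtoC_mult, <- RtoC_plus, <- RtoC_minus. f_equal.
      rewrite <- invariant_const with x. field. }
    assert (H4 : (lam * lam = (al x * al x + be x * be x - ga x * ga x) * (/ RtoC 2 * / RtoC 2))%C).
    { rewrite K. replace (RtoC 4) with (RtoC 2 * RtoC 2)%C
        by (rewrite <- RtoC_mult; f_equal; ring).
      field. }
    transitivity (((al x * al x + be x * be x - ga x * ga x) * (/ RtoC 2 * / RtoC 2)
      - lam * lam) * y x + - lam * y1 x)%C.
    { unfold y1, z1, Cdiv. ring [Ci_sqr]. }
    rewrite <- H4. ring.
  - apply (quad_of_eigen_relation lam y1 y z Q1 S).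
    intros x _. unfold y1. ring.
Qed.

End Reduction.

(** * Differential-integral polynomials in V *)

(** A real class holding all the S_k. Leaving out inverses and asking for antiderivatives on the
    whole line makes it closed under D_x, so its members are differentiable and integrable
    everywhere. *)
Inductive tame (V : R -> R) : (R -> R) -> Prop :=
| tame_const (c : R) : tame V (fun _ => c)
| tame_V (n : nat) : tame V (Derive_n V n)
| tame_plus (f h : R -> R) : tame V f -> tame V h -> tame V (fun x => f x + h x)
| tame_mult (f h : R -> R) : tame V f -> tame V h -> tame V (fun x => f x * h x)
| tame_int (f h : R -> R) : tame V h -> (forall x, is_derive f x (h x)) -> tame V f.

Lemma tame_quad V f a b : tame V f -> quad V a b (fun x => RtoC (f x)).
Proof.
  induction 1 as [c|n|f h _ IHf _ IHh|f h _ IHf _ IHh|f h _ IH D].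
  - constructor.
  - constructor.
  - apply q_ext with (fun x => RtoC (f x) + RtoC (h x))%C; [now apply q_add|].
    intros; apply RtoC_plus.
  - apply q_ext with (fun x => RtoC (f x) * RtoC (h x))%C; [now apply q_mul|].
    intros; apply RtoC_mult.
  - apply q_int with (fun x => RtoC (h x)); [easy|].
    intros x _. apply is_derive_RtoC, D.
Qed.

Section Tame.

Variable V : R -> R.
Hypothesis smoothV : smooth V.

Lemma tame_is_derive f :
  tame V f -> exists f', tame V f' /\ forall x, is_derive f x (f' x).
Proof.
  induction 1 as [c|n|f h Tf [f' [Tf' Df]] Th [h' [Th' Dh]]
                 |f h Tf [f' [Tf' Df]] Th [h' [Th' Dh]]|f h Th _ D].
  - exists (fun _ => 0). split; [constructor|].
    intros x. exact (@is_derive_const R_AbsRing R_NormedModule c x).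
  - exists (Derive_n V (S n)). split; [constructor|].
    intros x. apply Derive_correct, (smoothV (S n) x).
  - exists (fun x => f' x + h' x). split; [now constructor|].
    intros x. now apply (@is_derive_plus R_AbsRing R_NormedModule).
  - exists (fun x => f' x * h x + f x * h' x). split; [repeat constructor; easy|].
    intros x. now apply Derive.is_derive_mult.
  - now exists h.
Qed.

Lemma tame_ex_derive f x : tame V f -> ex_derive f x.
Proof. intros T. destruct (tame_is_derive f T) as [f' [_ D]]. now exists (f' x). Qed.

Lemma tame_Derive_correct f x : tame V f -> is_derive f x (Derive f x).
Proof. intros T. now apply Derive_correct, tame_ex_derive. Qed.

Lemma tame_Derive f : tame V f -> tame V (Derive f).
Proof.
  intros T. destruct (tame_is_derive f T) as [f' [T' D]].
  replace (Derive f) with f'; [exact T'|].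
  apply functional_extensionality; intros x. symmetry. now apply is_derive_unique.
Qed.

Lemma tame_continuous f x : tame V f -> continuous f x.
Proof.
  intros T. now apply (@ex_derive_continuous R_AbsRing R_NormedModule), tame_ex_derive.
Qed.

Lemma tame_ex_RInt f s t : tame V f -> ex_RInt f s t.
Proof.
  intros T. apply (@ex_RInt_continuous R_CompleteNormedModule).
  intros z _. now apply tame_continuous.
Qed.

Lemma tame_is_derive_RInt f x : tame V f -> is_derive (fun t => RInt f 0 t) x (f x).
Proof.
  intros T. apply (is_derive_RInt f _ 0 x); [|now apply tame_continuous].
  exists (mkposreal 1 Rlt_0_1). intros y _.
  now apply (@RInt_correct R_CompleteNormedModule), tame_ex_RInt.
Qed.

Lemma tame_RInt f : tame V f -> tame V (fun t => RInt f 0 t).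
Proof.
  intros T. apply tame_int with f; [easy|]. intros x. now apply tame_is_derive_RInt.
Qed.

Lemma tame_self : tame V V.
Proof. exact (tame_V V 0). Qed.

Lemma tame_Yop f : tame V f -> tame V (Yop V f).
Proof.
  intros T. unfold Yop. apply tame_plus; [apply tame_plus|].
  - exact (tame_Derive _ (tame_Derive f T)).
  - apply tame_mult; [|easy]. simpl.
    apply tame_mult; [apply tame_self|].
    apply tame_mult; [apply tame_self | constructor].
  - apply tame_mult; [exact (tame_V V 1)|].
    apply tame_RInt, tame_mult; [apply tame_self | easy].
Qed.

Lemma tame_Ssym k : tame V (Ssym V k).
Proof. induction k as [|k IH]; [exact (tame_V V 1) | exact (tame_Yop _ IH)]. Qed.

Lemma tame_sum_n (F : nat -> R -> R) n :
  (forall k, tame V (F k)) -> tame V (fun x => sum_n (fun k => F k x) n).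
Proof.
  intros T. induction n as [|n IH].
  - replace (fun x => sum_n (fun k => F k x) 0) with (F 0%nat); [easy|].
    apply functional_extensionality; intros x. now rewrite sum_O.
  - replace (fun x => sum_n (fun k => F k x) (S n))
      with (fun x => sum_n (fun k => F k x) n + F (S n) x); [now apply tame_plus|].
    apply functional_extensionality; intros x. now rewrite sum_Sn.
Qed.

(** * Linearity of the recursion operator and division of the stationary equation by Y - mu *)

Lemma YopE f x :
  Yop V f x =
  Derive (Derive f) x + V x ^ 2 * f x + Derive V x * RInt (fun t => V t * f t) 0 x.
Proof. reflexivity. Qed.

Lemma Yop_plus f h x :
  tame V f -> tame V h -> Yop V (fun t => f t + h t) x = Yop V f x + Yop V h x.
Proof.
  intros Tf Th. rewrite !YopE.
  rewrite (Derive_ext (Derive (fun t => f t + h t)) (fun t => Derive f t + Derive h t)).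
  2:{ intros t. apply Derive_plus; now apply tame_ex_derive. }
  rewrite Derive_plus by now apply tame_ex_derive, tame_Derive.
  assert (I : RInt (fun t => V t * (f t + h t)) 0 x =
    RInt (fun t => V t * f t) 0 x + RInt (fun t => V t * h t) 0 x).
  { rewrite (RInt_ext _ (fun t => V t * f t + V t * h t)) by (intros; apply Rmult_plus_distr_l).
    apply (@RInt_plus R_CompleteNormedModule);
      apply tame_ex_RInt, tame_mult; auto using tame_self. }
  rewrite I. ring.
Qed.

Lemma Yop_scal c f x : tame V f -> Yop V (fun t => c * f t) x = c * Yop V f x.
Proof.
  intros Tf. rewrite !YopE.
  rewrite (Derive_ext (Derive (fun t => c * f t)) (fun t => c * Derive f t)).
  2:{ intros t. apply Derive_scal. }
  rewrite Derive_scal.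
  assert (I : RInt (fun t => V t * (c * f t)) 0 x = c * RInt (fun t => V t * f t) 0 x).
  { rewrite (RInt_ext _ (fun t => c * (V t * f t))) by (intros; simpl; ring).
    apply (@RInt_scal R_CompleteNormedModule).
    apply tame_ex_RInt, tame_mult; auto using tame_self. }
  rewrite I. ring.
Qed.

Lemma Yop_sum_n (c : nat -> R) (F : nat -> R -> R) n x :
  (forall k, tame V (F k)) ->
  Yop V (fun t => sum_n (fun k => c k * F k t) n) x =
  sum_n (fun k => c k * Yop V (F k) x) n.
Proof.
  intros T.
  assert (Tc : forall k, tame V (fun t => c k * F k t)).
  { intros k. apply tame_mult; [constructor | easy]. }
  induction n as [|n IH].
  - replace (fun t => sum_n (fun k => c k * F k t) 0) with (fun t => c 0%nat * F 0%nat t).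
    + rewrite sum_O. now apply Yop_scal.
    + apply functional_extensionality; intros t. now rewrite sum_O.
  - replace (fun t => sum_n (fun k => c k * F k t) (S n))
      with (fun t => sum_n (fun k => c k * F k t) n + c (S n) * F (S n) t).
    + rewrite Yop_plus, IH, Yop_scal, sum_Sn; auto.
      now apply (tame_sum_n (fun k t => c k * F k t)).
    + apply functional_extensionality; intros t. now rewrite sum_Sn.
Qed.

(* Horner's scheme: [H 0] is the remainder and [H (S k)] the coefficients of the quotient of the
   division of [sum c_k X^k] by [X - mu]. *)
Lemma horner_exists (mu : R) (N : nat) : forall c : nat -> R,
  exists H : nat -> R,
    (forall k, (k <= N)%nat -> H k = c k + mu * H (S k)) /\ H (S N) = 0.
Proof.
  induction N as [|N IH]; intros c.
  - exists (fun k => match k with O => c 0%nat | _ => 0 end). split; [|easy].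
    intros k Hk. replace k with 0%nat by lia. simpl. ring.
  - destruct (IH (fun k => c (S k))) as [H [H1 H2]].
    exists (fun k => match k with O => c 0%nat + mu * H 0%nat | S k => H k end).
    split; [|exact H2].
    intros [|k] Hk; [easy|]. apply H1. lia.
Qed.

(** For s k = S_k this reads sum C_k S_k = p V' + Y u - mu u, with p = H 0 and u = sum H(k+1) S_k.
    The last term vanishes only at the full degree; keeping it lets the induction on [N] pass
    through partial sums. *)
Lemma horner_sum (mu : R) (c H s : nat -> R) (N : nat) :
  (forall k, (k <= N)%nat -> H k = c k + mu * H (S k)) ->
  (sum_n (fun k => c k * s k) N : R) =
  H 0%nat * s 0%nat + sum_n (fun k => H (S k) * s (S k)) N
  - mu * sum_n (fun k => H (S k) * s k) N
  - H (S N) * s (S N).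
Proof.
  induction N as [|N IH]; intros E.
  - rewrite !sum_O. rewrite (E 0%nat) by lia. ring.
  - rewrite !sum_Sn. change (@plus _) with Rplus. rewrite IH by (intros; apply E; lia).
    rewrite (E (S N)) by lia. ring.
Qed.

(** The division may yield the useless pair u = 0, p = 0. In that case the quotient is itself a
    stationary equation of lower order with nonzero coefficients, and the division is repeated on
    it. *)
Lemma eigenfunction_exists (mu : R) (N : nat) : forall Cs : nat -> R,
  (exists k, (k <= N)%nat /\ Cs k <> 0) -> stationary_mKdV V N Cs ->
  exists (u : R -> R) (p : R), tame V u /\
    (forall x, Yop V u x = mu * u x - p * Derive V x) /\
    ~ (p = 0 /\ forall x, u x = 0).
Proof.
  induction N as [|N IH]; intros Cs [j [Hj Cj]] St.
  (* For N = 0 the equation is C_0 V' = 0, so the quotient is zero and the remainder C_0 is not. *)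
  - exists (fun _ => 0), (Cs 0%nat). split; [constructor|]. split.
    + intros x. specialize (St x). rewrite sum_O in St. unfold Ssym in St; simpl in St.
      rewrite St.
      replace (fun _ : R => 0) with (fun t : R => 0 * V t)
        by (apply functional_extensionality; intros; ring).
      rewrite Yop_scal by apply tame_self. ring.
    + intros [E _]. apply Cj. now replace j with 0%nat by lia.
  - destruct (horner_exists mu (S N) Cs) as [H [H1 H2]].
    destruct (classic
      (H 0%nat = 0 /\ forall x, sum_n (fun k => H (S k) * Ssym V k x) (S N) = 0))
      as [[H0 Z]|Z].
    + apply (IH (fun k => H (S k))).
      (* If the quotient vanished along with the remainder, C_j = H j - mu H(j+1) would be zero for
         every j. *)
      * apply NNPP. intros F.
        assert (F' : forall k, (k <= S (S N))%nat -> H k = 0).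
        { intros [|k] Hk; [easy|].
          destruct (Nat.eq_dec k (S N)) as [->|]; [easy|].
          apply NNPP. intros G. apply F. exists k. split; [lia | easy]. }
        specialize (H1 j Hj). rewrite !F' in H1 by lia. apply Cj. lra.
      (* The top term carries H(N+2) = 0, so the sum already stops at [N]. *)
      * intros x. specialize (Z x). rewrite sum_Sn, H2 in Z. unfold plus in Z; simpl in Z.
        rewrite Rmult_0_l, Rplus_0_r in Z. exact Z.
    + exists (fun x => sum_n (fun k => H (S k) * Ssym V k x) (S N)), (H 0%nat).
      split; [|split; [|exact Z]].
      * apply (tame_sum_n (fun k t => H (S k) * Ssym V k t)).
        intros k. apply tame_mult; [constructor | apply tame_Ssym].
      * intros x. rewrite (Yop_sum_n (fun k => H (S k)) (Ssym V)) by apply tame_Ssym.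
        pose proof (horner_sum mu Cs H (fun k => Ssym V k x) (S N) H1) as E.
        cbv beta in E. rewrite (St x : (_ : R) = _), H2 in E.
        change (fun k => H (S k) * Yop V (Ssym V k) x)
          with (fun k => H (S k) * Ssym V (S k) x).
        change (Ssym V 0 x) with (Derive V x) in E. lra.
Qed.

End Tame.

(* [E = al^2 + be^2 + ga^2] satisfies [|E'| <= 2 |m| E]: the terms with [V] cancel. *)
Lemma invariant_vanishes (V al be ga : R -> R) (m x0 : R) :
  (forall x, is_derive al x (m * ga x - V x * be x)) ->
  (forall x, is_derive be x (V x * al x)) ->
  (forall x, is_derive ga x (m * al x)) ->
  al x0 = 0 -> be x0 = 0 -> ga x0 = 0 ->
  forall x, al x = 0 /\ be x = 0 /\ ga x = 0.
Proof.
  intros Da Db Dg a0 b0 g0.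
  pose (E x := al x ^ 2 + be x ^ 2 + ga x ^ 2).
  (* The product of E with exp(2 s |m| t) is nondecreasing for s = 1 and nonincreasing for s = -1.
     The first carries the zero at [x0] to the left, the second to the right. *)
  assert (DE : forall s x,
    is_derive (fun t => E t * exp (s * (2 * Rabs m) * t)) x
      ((4 * m * (al x * ga x) + s * (2 * Rabs m) * E x) * exp (s * (2 * Rabs m) * x))).
  { intros s x. unfold E. auto_derive.
    - repeat split; [eexists; apply Da | eexists; apply Db | eexists; apply Dg].
    - assert (E1 : Derive (fun x => al x) x = _) by (apply is_derive_unique, Da).
      assert (E2 : Derive (fun x => be x) x = _) by (apply is_derive_unique, Db).
      assert (E3 : Derive (fun x => ga x) x = _) by (apply is_derive_unique, Dg).
      rewrite E1, E2, E3. ring. }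
  assert (bound : forall x, Rabs (4 * m * (al x * ga x)) <= 2 * Rabs m * E x).
  { intros x. replace (4 * m * (al x * ga x)) with (2 * m * (2 * (al x * ga x))) by ring.
    rewrite Rabs_mult, (Rabs_mult 2 m), (Rabs_right 2) by lra.
    apply Rmult_le_compat_l; [pose proof (Rabs_pos m); lra|].
    unfold E. pose proof (pow2_ge_0 (al x + ga x)). pose proof (pow2_ge_0 (al x - ga x)).
    pose proof (pow2_ge_0 (be x)). apply Rabs_le. split; lra. }
  assert (E0 : E x0 = 0) by (unfold E; rewrite a0, b0, g0; ring).
  assert (Epos : forall x, 0 <= E x) by (intros; unfold E; nra).
  assert (key : forall x, E x = 0).
  { intros x. apply Rle_antisym; [|apply Epos].
    assert (mvt : forall s, exists c,
      E x * exp (s * (2 * Rabs m) * x) =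
      (4 * m * (al c * ga c) + s * (2 * Rabs m) * E c)
        * exp (s * (2 * Rabs m) * c) * (x - x0)).
    { intros s.
      destruct (MVT_gen (fun t => E t * exp (s * (2 * Rabs m) * t)) x0 x
        (fun c => (4 * m * (al c * ga c) + s * (2 * Rabs m) * E c)
        * exp (s * (2 * Rabs m) * c))) as [c [_ Hc]].
      - intros t _. apply DE.
      - intros t _. apply continuity_pt_filterlim.
        
        apply (@ex_derive_continuous R_AbsRing R_NormedModule
                 (fun t => E t * exp (s * (2 * Rabs m) * t))).
        eexists. exact (DE s t).
      - exists c. rewrite <- Hc. rewrite E0. ring. }
    destruct (Rle_dec x x0) as [Hx|Hx].
    - destruct (mvt 1) as [c Hc].
      pose proof (bound c) as B. apply Rabs_le_between in B.
      pose proof (exp_pos (1 * (2 * Rabs m) * c)) as P.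
      pose proof (exp_pos (1 * (2 * Rabs m) * x)) as Q.
      assert (0 <= (4 * m * (al c * ga c) + 1 * (2 * Rabs m) * E c)
         * exp (1 * (2 * Rabs m) * c)) by (apply Rmult_le_pos; lra).
      apply Rmult_le_reg_r with (1 := Q). rewrite Rmult_0_l, Hc. nra.
    - destruct (mvt (-1)) as [c Hc].
      pose proof (bound c) as B. apply Rabs_le_between in B.
      pose proof (exp_pos (-1 * (2 * Rabs m) * c)) as P.
      pose proof (exp_pos (-1 * (2 * Rabs m) * x)) as Q.
      assert (0 <= - (4 * m * (al c * ga c) + -1 * (2 * Rabs m) * E c)
         * exp (-1 * (2 * Rabs m) * c)) by (apply Rmult_le_pos; lra).
      apply Rmult_le_reg_r with (1 := Q). rewrite Rmult_0_l, Hc. nra. }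
  intros x. specialize (key x). unfold E in key.
  assert (al x = 0) by nra. assert (be x = 0) by nra. assert (ga x = 0) by nra. auto.
Qed.

Lemma continuous_neq0_locally (f : R -> R) (x : R) :
  continuous f x -> f x <> 0 -> locally x (fun t => f t <> 0).
Proof.
  intros Hf Hx. apply (Hf (fun r => r <> 0)).
  exists (mkposreal _ (Rabs_pos_lt _ Hx)). intros r Hr E.
  assert (Hr' : Rabs (r - f x) < Rabs (f x)) by exact Hr.
  rewrite E, Rminus_0_l, Rabs_Ropp in Hr'. lra.
Qed.

(** * Construction of the invariant and choice of the subinterval *)

Lemma quad_reduced_system_exists (V : R -> R) (m : R) (N : nat) (Cs : nat -> R) (a b : R) :
  smooth V -> (exists k, (k <= N)%nat /\ Cs k <> 0) -> stationary_mKdV V N Cs -> a < b ->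
  exists a' b', a <= a' /\ a' < b' /\ b' <= b /\
    forall y z, reduced_system V m y z -> quad V a' b' y /\ quad V a' b' z.
Proof.
  intros smV HC St ab.
  assert (Vc := fun x => tame_continuous V smV V x (tame_self V)).
  (* For m = 0 the components al = m u and be = m w would vanish and Q could not eliminate z, so
     this case is treated directly. *)
  destruct (Req_dec m 0) as [->|Hm].
  { exists a, b. repeat split; try lra.
    - apply (quad_linear_ode V a b (fun x => Ci / RtoC 2 * RtoC (V x))%C (fun _ => RtoC 0)); auto.
      + apply quad_scal, tame_quad, tame_self.
      + constructor.
      + intros x _. apply continuous_Re_Im_mult;
          [apply continuous_Re_Im_const | apply continuous_Re_Im_RtoC, Vc].
      + intros x _. eapply is_derive_eq; [exact (proj1 (H x))|]. ring.
    - apply (quad_linear_ode V a b (fun x => - (Ci / RtoC 2) * RtoC (V x))%C (fun _ => RtoC 0));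
        auto.
      + apply quad_scal, tame_quad, tame_self.
      + constructor.
      + intros x _. apply continuous_Re_Im_mult;
          [apply continuous_Re_Im_const | apply continuous_Re_Im_RtoC, Vc].
      + intros x _. eapply is_derive_eq; [exact (proj2 (H x))|]. ring. }
  destruct (eigenfunction_exists V smV (m * m) N Cs HC St) as [u [p [Tu [Eu nu]]]].
  assert (TVu : tame V (fun t => V t * u t)) by (apply tame_mult; auto using tame_self).
  pose (w x := p + RInt (fun t => V t * u t) 0 x).
  assert (Tw : tame V w).
  { apply tame_plus; [constructor | now apply tame_RInt]. }
  assert (Dw : forall x, is_derive w x (V x * u x)).
  { intros x. replace (V x * u x) with (0 + V x * u x) by ring.
    apply (@is_derive_plus R_AbsRing R_NormedModule).
    - exact (@is_derive_const R_AbsRing R_NormedModule p x).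
    - exact (tame_is_derive_RInt V smV (fun t => V t * u t) x TVu). }
  pose (al x := m * u x). pose (be x := m * w x). pose (ga x := Derive u x + V x * w x).
  assert (Tal : tame V al) by (apply tame_mult; [constructor | easy]).
  assert (Tbe : tame V be) by (apply tame_mult; [constructor | easy]).
  assert (Tga : tame V ga).
  { apply tame_plus; [now apply tame_Derive | apply tame_mult; auto using tame_self]. }
  assert (Dal : forall x, is_derive al x (m * ga x - V x * be x)).
  { intros x. replace (m * ga x - V x * be x) with (m * Derive u x) by (unfold ga, be; ring).
    now apply is_derive_scal, (tame_Derive_correct V). }
  assert (Dbe : forall x, is_derive be x (V x * al x)).
  { intros x. replace (V x * al x) with (m * (V x * u x)) by (unfold al; ring).
    apply is_derive_scal, Dw. }
  (* Since w contains p, ga' = u'' + V' w + V^2 u = Y u + p V' = m^2 u. *)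
  assert (Dga : forall x, is_derive ga x (m * al x)).
  { intros x. specialize (Eu x). rewrite YopE in Eu.
    replace (m * al x) with (Derive (Derive u) x + (Derive V x * w x + V x * (V x * u x)))
      by (unfold al, w; lra).
    apply (@is_derive_plus R_AbsRing R_NormedModule).
    - now apply (tame_Derive_correct V), tame_Derive.
    - apply Derive.is_derive_mult; [apply (tame_Derive_correct V); auto using tame_self|].
      apply Dw. }
  (* If al and be vanished on all of (a, b), then al' = m ga - V be would force ga = 0 at the
     midpoint. Uniqueness then makes Q zero on the whole line, against the nontriviality of (u,
     p). *)
  assert (HX : exists x0, a < x0 < b /\ al x0 ^ 2 + be x0 ^ 2 <> 0).
  { apply NNPP. intros F.
    assert (Z : forall x, a < x < b -> al x = 0 /\ be x = 0).
    { intros x Hx. destruct (Req_dec (al x ^ 2 + be x ^ 2) 0) as [e|e].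
      - split; nra.
      - exfalso. apply F. now exists x. }
    pose (c := (a + b) / 2). assert (Hc : a < c < b) by (unfold c; lra).
    assert (Gc : ga c = 0).
    { assert (D0 : is_derive al c 0).
      { apply (is_derive_ext_loc (fun _ => 0)).
        - apply (locally_interval _ c a b); try easy.
          intros t H1 H2. symmetry. now apply Z.
        - exact (@is_derive_const R_AbsRing R_NormedModule 0 c). }
      apply is_derive_unique in D0. pose proof (is_derive_unique _ _ _ (Dal c)) as D1.
      rewrite D0, (proj2 (Z c Hc)) in D1.
      assert (P : m * ga c = 0) by lra.
      apply Rmult_integral in P. now destruct P. }
    assert (V0 := invariant_vanishes V al be ga m c Dal Dbe Dga
                    (proj1 (Z c Hc)) (proj2 (Z c Hc)) Gc).
    apply nu. split.
    (* At the base point 0 the integral in w is empty, so be 0 = m p. *)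
    - destruct (V0 0) as [_ [B _]]. unfold be, w in B. rewrite RInt_point in B.
      apply Rmult_integral in B. destruct B as [B|B]; [easy|].
      change (p + 0 = 0) in B. lra.
    - intros x. destruct (V0 x) as [A _]. unfold al in A.
      apply Rmult_integral in A. now destruct A. }
  destruct HX as [x0 [Hx0 nz0]].
  assert (Tr : tame V (fun x => al x * al x + be x * be x))
    by (apply tame_plus; now apply tame_mult).
  destruct (continuous_neq0_locally (fun x => al x * al x + be x * be x) x0) as [e He].
  { exact (tame_continuous V smV _ x0 Tr). }
  { contradict nz0. lra. }
  (* The intersection of (a, b) with the ball around [x0] on which al^2 + be^2 has no zero; it does
     not depend on the solution. *)
  exists (Rmax a (x0 - e)), (Rmin b (x0 + e)).
  assert (e0 := cond_pos e).
  assert (Hab' : Rmax a (x0 - e) < Rmin b (x0 + e)).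
  { apply Rmax_lub_lt; apply Rmin_glb_lt; lra. }
  split; [apply Rmax_l|]. split; [easy|]. split; [apply Rmin_l|].
  intros y z. apply (quad_reduced_system V m _ _ al be ga); auto using tame_quad, tame_self.
  intros x [H1 H2].
  assert (P : al x * al x + be x * be x <> 0).
  { apply He. change (Rabs (x - x0) < e).
    pose proof (Rmax_r a (x0 - e)). pose proof (Rmin_r b (x0 + e)). apply Rabs_def1; lra. }
  contradict P. lra.
Qed.

(** * Splitting of the Dirac system *)

Definition apply_mx (A : cmat) (v : nat -> C) : nat -> C := fun i =>
  (A i 0%nat * v 0%nat + A i 1%nat * v 1%nat + A i 2%nat * v 2%nat + A i 3%nat * v 3%nat)%C.

(** The gamma identities hold only at indices below 4, so they are rewritten under a matrix by this
    lemma and not by functional extensionality. *)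
Lemma apply_mx_ext A u v i :
  (forall k, (k < 4)%nat -> u k = v k) -> apply_mx A u i = apply_mx A v i.
Proof. intros H. unfold apply_mx. rewrite !H by lia. reflexivity. Qed.

Lemma apply_mx_lin A (s r : C) u v i :
  (apply_mx A (fun k => s * u k + r * v k) i = s * apply_mx A u i + r * apply_mx A v i)%C.
Proof. unfold apply_mx. ring. Qed.

Lemma apply_mx_anticomm g mu nu v i :
  is_Dirac g -> (mu < 4)%nat -> (nu < 4)%nat -> (i < 4)%nat ->
  (apply_mx (g mu) (apply_mx (g nu) v) i + apply_mx (g nu) (apply_mx (g mu) v) i
   = RtoC (2 * minkowski mu nu) * v i)%C.
Proof.
  intros Dg Hmu Hnu Hi.
  transitivity (apply_mx (fun i j => cmmul (g mu) (g nu) i j + cmmul (g nu) (g mu) i j) v i)%C.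
  { unfold apply_mx, cmmul. ring. }
  unfold apply_mx. rewrite !Dg by lia.
  destruct i as [|[|[|[|i]]]]; try lia; unfold kdelta; simpl; ring.
Qed.

Lemma is_derive_apply_mx A (v : nat -> R -> C) (dv : nat -> C) i x :
  (forall k, (k < 4)%nat -> is_derive (v k) x (dv k)) ->
  is_derive (fun t => apply_mx A (fun k => v k t) i) x (apply_mx A dv i).
Proof.
  intros H. unfold apply_mx.
  repeat apply is_derive_Cplus; apply is_derive_Cscal, H; lia.
Qed.

Section Dirac.

Variable g : nat -> cmat.
Hypothesis Dg : is_Dirac g.

(** [P] and [Q] stand for gamma_0 and gamma_3 acting on vectors; this [Q] is not the invariant
    matrix of the reduction. *)
Let P := apply_mx (g 0%nat).
Let Q := apply_mx (g 3%nat).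

Lemma gamma0_gamma0 v i : (i < 4)%nat -> P (P v) i = v i.
Proof.
  intros Hi.
  assert (H : (P (P v) i + P (P v) i = RtoC (2 * 1) * v i)%C)
    by (apply (apply_mx_anticomm g 0 0); auto with arith).
  rewrite Rmult_1_r in H.
  transitivity (/ RtoC 2 * (P (P v) i + P (P v) i))%C; [field|].
  rewrite H. field.
Qed.

Lemma gamma3_gamma3 v i : (i < 4)%nat -> Q (Q v) i = (- v i)%C.
Proof.
  intros Hi.
  assert (H : (Q (Q v) i + Q (Q v) i = RtoC (2 * -1) * v i)%C)
    by (apply (apply_mx_anticomm g 3 3); auto with arith).
  replace (RtoC (2 * -1)) with (- RtoC 2)%C in H by (apply C_ext; simpl; ring).
  transitivity (/ RtoC 2 * (Q (Q v) i + Q (Q v) i))%C; [field|].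
  rewrite H. field.
Qed.

Lemma gamma0_gamma3 v i : (i < 4)%nat -> P (Q v) i = (- Q (P v) i)%C.
Proof.
  intros Hi.
  assert (H : (P (Q v) i + Q (P v) i = RtoC (2 * 0) * v i)%C)
    by (apply (apply_mx_anticomm g 0 3); auto with arith).
  rewrite Rmult_0_r in H.
  transitivity ((P (Q v) i + Q (P v) i) - Q (P v) i)%C; [ring|].
  rewrite H. ring.
Qed.

(* [y] and [z] are, up to scalars, [u] and [J1 w] where [phi = u + w] with
   [J3 u = (i/2) u] and [J3 w = -(i/2) w]. *)
Lemma reduce_system V m phi :
  is_solution g V m phi ->
  exists y z : nat -> R -> C,
    (forall i, (i < 4)%nat -> reduced_system V m (y i) (z i)) /\
    (forall i x, (i < 4)%nat ->
      phi i x = (/ RtoC 2 * (y i x + apply_mx (g 0%nat) (fun k => z k x) i))%C).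
Proof.
  intros S.
  (* As (gamma_3 gamma_0)^2 = 1, the matrices 1 + gamma_3 gamma_0 and 1 - gamma_3 gamma_0 are twice
     the projections onto the eigenspaces of J3. The witnesses are y = (1 + gamma_3 gamma_0) phi and
     z = gamma_0 (1 - gamma_3 gamma_0) phi = (gamma_0 + gamma_3) phi. As gamma_0 exchanges the
     eigenspaces, y and z lie in the same one, and the system acts on each index separately. *)
  exists (fun i x => phi i x + Q (P (fun k => phi k x)) i)%C,
         (fun i x => P (fun k => phi k x) i + Q (fun k => phi k x) i)%C.
  split.
  - intros i Hi x. cbv beta.
    set (c := (Ci / RtoC 2)%C). set (v := fun k => phi k x).
    set (dv := fun k => (c * RtoC (V x) * Q (P v) k + c * RtoC m * Q v k)%C).
    assert (Dv : forall k, (k < 4)%nat -> is_derive (phi k) x (dv k)).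
    { intros k Hk. eapply is_derive_eq; [apply (S k x Hk)|].
      unfold dv, Q, P, apply_mx, Amat, J3, J2, cmmul, v. fold c. ring. }
    assert (Pdv : forall k, (k < 4)%nat ->
      P dv k = (- (c * RtoC (V x)) * Q v k + - (c * RtoC m) * Q (P v) k)%C).
    { intros k Hk. unfold P at 1, dv. rewrite apply_mx_lin. fold P.
      rewrite !gamma0_gamma3 by easy.
      replace (Q (P (P v)) k) with (Q v k); [ring|].
      apply apply_mx_ext. intros j Hj. symmetry. now apply gamma0_gamma0. }
    assert (Qdv : Q dv i = (- (c * RtoC (V x)) * P v i + - (c * RtoC m) * v i)%C).
    { unfold Q at 1, dv. rewrite apply_mx_lin. fold Q.
      rewrite !gamma3_gamma3 by easy. ring. }
    assert (QPdv : Q (P dv) i = (c * RtoC (V x) * v i + c * RtoC m * P v i)%C).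
    { unfold Q at 1. rewrite (apply_mx_ext _ _ _ i Pdv), apply_mx_lin. fold Q.
      rewrite !gamma3_gamma3 by easy. ring. }
    assert (DP : forall k, is_derive (fun t => P (fun j => phi j t) k) x (P dv k)).
    { intros k. now apply is_derive_apply_mx. }
    assert (DQ : is_derive (fun t => Q (fun j => phi j t) i) x (Q dv i)).
    { now apply is_derive_apply_mx. }
    assert (DQP : is_derive (fun t => Q (P (fun j => phi j t)) i) x (Q (P dv) i)).
    { apply (is_derive_apply_mx (g 3%nat) (fun k t => P (fun j => phi j t) k) (P dv)).
      intros k _. apply DP. }
    change (phi i x) with (v i).
    split.
    + eapply is_derive_eq; [exact (is_derive_Cplus _ _ _ _ _ (Dv i Hi) DQP)|].
      rewrite QPdv. unfold dv. ring.
    + eapply is_derive_eq; [exact (is_derive_Cplus _ _ _ _ _ (DP i) DQ)|].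
      rewrite (Pdv i Hi), Qdv. ring.
  - intros i x Hi. fold P.
    set (v := fun k => phi k x).
    assert (Padd : forall s r, (P (fun k => s k + r k) i = P s i + P r i)%C)
      by (intros; unfold P, apply_mx; ring).
    rewrite Padd, gamma0_gamma0, gamma0_gamma3 by easy. change (phi i x) with (v i). field.
Qed.

End Dirac.

Theorem theorem1 (g : nat -> cmat) (m : R) (V : R -> R) (N : nat) (Cs : nat -> R) :
  is_Dirac g ->
  smooth V ->
  (exists k : nat, (k <= N)%nat /\ Cs k <> 0) ->
  stationary_mKdV V N Cs ->
  forall a b : R, a < b ->
    exists a' b' : R, a <= a' /\ a' < b' /\ b' <= b /\
      forall phi : nat -> R -> C, is_solution g V m phi ->
        forall i : nat, (i < 4)%nat -> quad V a' b' (phi i).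
Proof.
  intros Dg smV HC St a b ab.
  destruct (quad_reduced_system_exists V m N Cs a b smV HC St ab)
    as [a' [b' [H1 [H2 [H3 H]]]]].
  exists a', b'. repeat split; auto. intros phi Hphi i Hi.
  destruct (reduce_system g Dg V m phi Hphi) as [y [z [Hyz E]]].
  apply q_ext with
    (fun x => / RtoC 2 * (y i x + apply_mx (g 0%nat) (fun k => z k x) i))%C.
  2:{ intros x _. now apply E. }
  apply quad_scal, q_add; [exact (proj1 (H _ _ (Hyz i Hi)))|].
  unfold apply_mx.
  assert (Qz : forall k, (k < 4)%nat -> quad V a' b' (fun x => g 0%nat i k * z k x)%C).
  { intros k Hk. apply quad_scal. exact (proj2 (H _ _ (Hyz k Hk))). }
  repeat apply (q_add V a' b'); apply Qz; lia.
Qed.
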